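(* Let $v$ be a nonzero vector in $V=\mathbb C^X$ and let $g=\max\{i:0\le i\le D,\ E_iv\ne0\}$ be its dual width. Then for every $x\in X$ there exists a vertex $y$ in the support of $v$ such that $\partial(x,y)\ge D-g$.
   Context: Let $\Gamma=(X,R)$ be a finite connected distance-regular graph with path-length distance $\partial$ and diameter $D\ge3$, $Q$-polynomial with respect to the ordering $E_0,\dots,E_D$ of its primitive idempotents (the primitive idempotents of the Bose–Mesner algebra spanned by the distance matrices $A_i$, where $(A_i)_{yz}=1$ if $\partial(y,z)=i$ and $0$ otherwise; $Q$-polynomial means the Krein parameters $q^h_{ij}$, defined by $E_i\circ E_j=|X|^{-1}\sum_hq^h_{ij}E_h$ with $\circ$ the entrywise product, vanish whenever one of $h,i,j$ exceeds the sum of the other two and are nonzero whenever one equals the sum of the other two). The support of $v\in V$ is the set of $y\in X$ such that the $y$-coordinate of $v$ is nonzero. *)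

(* Defs.v *)
From HB Require Import structures.
From mathcomp Require Import all_boot all_order all_algebra.
Set Implicit Arguments. Unset Strict Implicit. Unset Printing Implicit Defensive.
Import Order.TTheory GRing.Theory Num.Theory.
Local Open Scope ring_scope.

Section DRG.
Variables (T : finType) (adj : rel T).

Definition walk_len (x y : T) (n : nat) : bool :=
  [exists p : n.-tuple T, path adj x p && (last x p == y)].

(* path-length distance: the least n with a walk of length n from x to y
   (for a connected graph this is < #|T|) *)
Definition dist (x y : T) : nat := find (walk_len x y) (iota 0 #|T|).

Definition diameter : nat := \max_(x : T) \max_(y : T) dist x y.

Definition connected_graph : Prop := forall x y : T, connect adj x y.

Definition simple_graph : Prop := symmetric adj /\ irreflexive adj.

Definition distance_regular : Prop :=
  forall h i j : nat, exists c : nat, forall x y : T, dist x y = h ->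
    #|[set z : T | (dist x z == i) && (dist z y == j)]| = c.

Variable C : numClosedFieldType.

Definition mxT := 'M[C]_#|T|.

Definition distA (i : nat) : mxT :=
  \matrix_(a, b) (dist (enum_val a) (enum_val b) == i)%:R.

Definition hadamard (M N : mxT) : mxT := \matrix_(a, b) (M a b * N a b).

Definition in_BM (M : mxT) : Prop :=
  exists c : nat -> C, M = \sum_(i < diameter.+1) c i *: distA i.

Definition idem (M : mxT) : Prop := M *m M = M.

Definition prim_idem (M : mxT) : Prop :=
  [/\ in_BM M, idem M, M != 0 &
      forall F : mxT, in_BM F -> idem F -> M *m F = F -> F = 0 \/ F = M].

Definition prim_idem_ordering (E : nat -> mxT) : Prop :=
  [/\ forall i, (i <= diameter)%N -> prim_idem (E i),
      forall i j, (i <= diameter)%N -> (j <= diameter)%N -> E i = E j -> i = j,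
      forall M, prim_idem M -> exists2 i, (i <= diameter)%N & M = E i &
      E 0%N = (#|T|%:R)^-1 *: const_mx 1].

Definition Q_polynomial (E : nat -> mxT) : Prop :=
  exists q : nat -> nat -> nat -> C,
    (forall i j, (i <= diameter)%N -> (j <= diameter)%N ->
       hadamard (E i) (E j) =
       (#|T|%:R)^-1 *: \sum_(h < diameter.+1) q h i j *: E h) /\
    (forall h i j, (h <= diameter)%N -> (i <= diameter)%N -> (j <= diameter)%N ->
       ((i + j < h)%N || (h + j < i)%N || (h + i < j)%N) -> q h i j = 0) /\
    (forall h i j, (h <= diameter)%N -> (i <= diameter)%N -> (j <= diameter)%N ->
       ((h == i + j)%N || (i == h + j)%N || (j == h + i)%N) -> q h i j != 0).

Definition vsupport (v : 'cV[C]_#|T|) : {set T} :=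
  [set y : T | v (enum_rank y) 0 != 0].

Definition dual_width (E : nat -> mxT) (v : 'cV[C]_#|T|) : nat :=
  \max_(i < diameter.+1 | E i *m v != 0) i.

End DRG.

(* Main.v *)
Require Import Defs.
From HB Require Import structures.
From mathcomp Require Import all_boot all_order all_algebra.
From mathcomp Require Import zify.
Import Order.TTheory GRing.Theory Num.Theory.
Local Open Scope ring_scope.
Set Implicit Arguments. Unset Strict Implicit. Unset Printing Implicit Defensive.

(** Fix x, with dual idempotents E*_k (projection onto the k-th sphere around x) and dual
    distance matrices A*_i. Let V_ij be the set of vectors supported within distance i of x
    and killed by E_k for k > j. The claim is that V_ij = 0 when i + j < D, and one may take
    i + j = D - 1. Since (A - theta_j) V_ij lies in V_(i+1)(j-1), and dually for A*_1, the sum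
    W of the V_ij with i + j = D - 1 is invariant under A and A*_1, hence under A_D and A*_D,
    which are injective by the three-term recurrences. Suppose V_i'j' = 0 on this antidiagonal
    whenever i' < m or j' < m. For u in V_m(D-1-m), the vector A_D u is supported at distance
    at least D - m from x but lies in W, whose vectors are supported within distance D - 1 - m;
    so A_D u = 0 and u = 0. The dual argument handles V_(D-1-m)m, and induction on m
    concludes. *)

(** * Matrix sequences with a three-term recurrence *)

Section ThreeTermRecurrence.
Variables (F : fieldType) (n D : nat) (X : nat -> 'M[F]_n).

(** The model for [p h i] is the intersection number $p^h_{1i}$ or, up to the factor $|X|^{-1}$, the
    Krein parameter $q^h_{1i}$. *)
Definition three_term : Prop := exists p : nat -> nat -> F,
  [/\ forall i, (i <= D)%N -> X 1 *m X i = \sum_(h < D.+1) p h i *: X h,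
      forall h i, (h <= D)%N -> (i <= D)%N ->
        (i.+1 < h)%N || (h.+1 < i)%N -> p h i = 0 &
      forall h i, (h <= D)%N -> (i <= D)%N ->
        (h == i.+1) || (i == h.+1) -> p h i != 0].

Hypothesis recX : three_term.
Hypothesis X0 : exists2 z, z != 0 & X 0%N = z%:M.

(** The recurrence is solved for its lowest term: once [X i.+1] and [X i.+2] kill [v], so does
    [X i], and the descent ends at a nonzero scalar matrix. *)
Lemma three_term_top_inj (v : 'cV[F]_n) : X D *m v = 0 -> v = 0.
Proof.
case: recX => p [pE p0 p1] XDv.
suff Xv k i : (i <= D)%N -> (D <= i + k)%N -> X i *m v = 0.
  have [z z0 zE] := X0.
  have := Xv D 0%N (leq0n _) (leqnn _).
  by rewrite zE mul_scalar_mx => /eqP; rewrite scaler_eq0 (negPf z0) => /eqP.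
elim: k i => [|k IHk] i iD; rewrite ?addn0 ?addnS => Di.
  by have -> : i = D by lia.
have [Di'|Di'] := leqP D (i + k); first exact: IHk.
have iD1 : (i < D)%N by lia.
have := congr1 (mulmx^~ v) (pE i.+1 iD1).
rewrite -mulmxA IHk ?mulmx0 //.
rewrite mulmx_suml (bigD1 (Ordinal (iD : (i < D.+1)%N))) //= big1.
  move/esym/eqP; rewrite addr0 -scalemxAl scaler_eq0 => /orP[|/eqP//].
  by rewrite (negPf (p1 _ _ _ _ _)) //= eqxx orbT.
move=> h; rewrite -val_eqE /= => hi; have hD : (h <= D)%N := leq_ord _.
have [hi'|ih] := ltnP h i.
  by rewrite p0 ?scale0r ?mul0mx //; apply/orP; right; lia.
by rewrite -scalemxAl IHk ?scaler0 //; lia.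
Qed.

(** The recurrence is solved for its highest term: [X i.+1 *m u] is a combination of
    [X 1 *m (X i *m u)] and of the [X h *m u] with [h <= i]. *)
Lemma three_term_invariant (W : 'cV[F]_n -> Prop) :
  W 0 -> (forall u v, W u -> W v -> W (u + v)) -> (forall c u, W u -> W (c *: u)) ->
  (forall u, W u -> W (X 1 *m u)) ->
  forall i u, (i <= D)%N -> W u -> W (X i *m u).
Proof.
case: recX => p [pE p0 p1] W0 WD WZ W1 i u + Wu.
elim/ltn_ind: i => -[|i] IHi iD.
  by have [z _ ->] := X0; rewrite mul_scalar_mx; apply: WZ.
have iD' : (i <= D)%N by lia.
have := congr1 (mulmx^~ u) (pE i iD').
rewrite -mulmxA mulmx_suml (bigD1 (Ordinal (iD : (i.+1 < D.+1)%N))) //=.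
rewrite -scalemxAl => /eqP; rewrite -subr_eq => /eqP/esym Ei.
have p1i : p i.+1 i != 0 by apply: p1; rewrite ?eqxx.
rewrite -[X _ *m u]scale1r -(mulVf p1i) -scalerA Ei.
apply/WZ/WD; last first.
  rewrite -scaleN1r; apply/WZ.
  apply: (big_ind W) => // h; rewrite -val_eqE /= => hi.
  have hD : (h <= D)%N := leq_ord _.
  have [hi'|ih] := ltnP i.+1 h; last by rewrite -scalemxAl; apply/WZ/IHi; lia.
  by rewrite p0 ?hi' // scale0r mul0mx.
by apply/W1/IHi; lia.
Qed.

End ThreeTermRecurrence.

(** * Filtrations from two resolutions of the identity *)

Section Filtrations.
Variables (F : fieldType) (n D : nat).
Implicit Types (P Q X : nat -> 'M[F]_n) (u v : 'cV[F]_n).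

(** For the dual idempotents this bounds the distance from [x] to the support; for the primitive
    idempotents it bounds the dual width. *)
Definition low P i v : Prop := forall k, (i < k <= D)%N -> P k *m v = 0.

Lemma low0 P i : low P i 0.
Proof. by move=> k _; rewrite mulmx0. Qed.

Lemma lowD P i u v : low P i u -> low P i v -> low P i (u + v).
Proof. by move=> Pu Pv k hk; rewrite mulmxDr Pu ?Pv ?addr0. Qed.

Lemma lowZ P i c u : low P i u -> low P i (c *: u).
Proof. by move=> Pu k hk; rewrite -scalemxAr Pu ?scaler0. Qed.

Lemma low_le P i j u : (i <= j)%N -> low P i u -> low P j u.
Proof. by move=> ij Pu k hk; apply: Pu; lia. Qed.

Definition resolution P : Prop := \sum_(k < D.+1) P k = 1%:M.

Lemma resolution_expand P (M : 'M[F]_n) v :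
  resolution P -> M *m v = \sum_(l < D.+1) M *m P l *m v.
Proof. by move=> P1; rewrite -mulmx_suml -mulmx_sumr P1 mulmx1. Qed.

Lemma resolution_eq0 P v :
  resolution P -> (forall k, (k <= D)%N -> P k *m v = 0) -> v = 0.
Proof.
move=> P1 Pv; rewrite -[v]mul1mx (resolution_expand _ _ P1) big1 // => l _.
by rewrite mul1mx Pv // -ltnS.
Qed.

(* The model is P = (E*_k), Q = (E_k), X = (A_i); the axioms are self-dual, so that
   P = (E_k), Q = (E*_k), X = (A*_i) is also an instance. *)
Record tridiagonal_half P Q X : Prop := TridiagonalHalf {
  half_res : resolution P;
  half_res' : resolution Q;
  half_eigen : exists th : nat -> F, forall k, (k <= D)%N -> Q k *m X 1%N = th k *: Q k;
  half_tri : forall k l, (k <= D)%N -> (l <= D)%N -> (l.+1 < k)%N -> P k *m X 1%N *m P l = 0;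
  half_far : forall k l, (k <= D)%N -> (l <= D)%N -> (k + l < D)%N -> P k *m X D *m P l = 0;
  half_rec : three_term D X;
  half_X0 : exists2 z, z != 0 & X 0%N = z%:M
}.

(** The space W, encoded so that linear claims about it reduce to its generators by induction. *)
Inductive diagonal_sum P Q : 'cV[F]_n -> Prop :=
| DiagonalGen i j v : (i + j).+1 = D -> low P i v -> low Q j v -> diagonal_sum P Q v
| DiagonalAdd u v : diagonal_sum P Q u -> diagonal_sum P Q v -> diagonal_sum P Q (u + v).

Lemma low_tri P Q X i v : tridiagonal_half P Q X -> low P i v -> low P i.+1 (X 1%N *m v).
Proof.
move=> H Pv k hk; rewrite mulmxA (resolution_expand _ _ (half_res H)) big1 // => l _.
have lD : (l <= D)%N := leq_ord _.
have [il|li] := ltnP i l; first by rewrite -mulmxA Pv ?mulmx0 // il.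
by rewrite (half_tri H) ?mul0mx //; lia.
Qed.

Lemma diagonal_sum_invariant P Q X u :
  tridiagonal_half P Q X -> diagonal_sum P Q u -> diagonal_sum P Q (X 1%N *m u).
Proof.
move=> H; elim=> [i j v ijD Pv Qv|? ? _ ? _ ?]; last by rewrite mulmxDr; apply: DiagonalAdd.
have [th thE] := half_eigen H.
(* The shift by [th j] kills the component at level [j]: [w] drops one level for [Q] and rises at
   most one for [P]. *)
set w := X 1%N *m v - th j *: v.
have Qw k : (k <= D)%N -> Q k *m w = (th k - th j) *: (Q k *m v).
  by move=> kD; rewrite mulmxBr mulmxA thE // -scalemxAl -scalemxAr scalerBl.
have -> : X 1%N *m v = w + th j *: v by rewrite subrK.
apply: DiagonalAdd; last by apply: (DiagonalGen ijD); apply: lowZ.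
have Qw' k : (j <= k <= D)%N -> Q k *m w = 0.
  case/andP=> jk kD; rewrite Qw //; case: ltngtP jk => // [jk|->] _.
    by rewrite Qv ?scaler0 // jk.
  by rewrite subrr scale0r.
(* For [j = 0] every [Q k] kills [w], so [w = 0]. *)
case: j => [|j] in ijD Qv w Qw Qw' *.
  rewrite (_ : w = 0); last by apply: (resolution_eq0 (half_res' H)) => k kD; apply: Qw'.
  by apply: (DiagonalGen ijD); apply: low0.
apply: (@DiagonalGen _ _ i.+1 j); [lia| |by move=> k hk; apply: Qw'].
apply: lowD; first exact: low_tri H Pv.
by rewrite -scaleN1r; apply/lowZ/lowZ/(low_le (leqnSn _)).
Qed.

Lemma diagonal_trivial_step P Q X m u :
  tridiagonal_half P Q X ->
  (forall i j v, (i + j).+1 = D -> (j < m)%N -> low P i v -> low Q j v -> v = 0) ->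
  (m < D)%N -> low P m u -> low Q (D.-1 - m) u -> u = 0.
Proof.
move=> H triv mD Pu Qu.
apply: (three_term_top_inj (half_rec H) (half_X0 H)).
have W0 : diagonal_sum P Q 0.
  by apply: (@DiagonalGen _ _ 0%N D.-1); [lia|apply: low0|apply: low0].
have WZ c w : diagonal_sum P Q w -> diagonal_sum P Q (c *: w).
  elim=> [i j v ijD Pv Qv|? ? _ ? _ ?]; last by rewrite scalerDr; apply: DiagonalAdd.
  by apply: (DiagonalGen ijD); apply: lowZ.
have Wu : diagonal_sum P Q (X D *m u).
  apply: (three_term_invariant (half_rec H) (half_X0 H)) => //.
  - exact: DiagonalAdd.
  - by move=> w; apply: diagonal_sum_invariant.
  - by apply: (@DiagonalGen _ _ m (D.-1 - m)) => //; lia.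
have Wlow : low P (D.-1 - m) (X D *m u).
  elim: Wu => [i j v ijD Pv Qv|? ? _ ? _ ?]; last exact: lowD.
  (* Generators with [j < m] vanish; the others have [i <= D.-1 - m]. *)
  have [jm|mj] := ltnP j m; first by rewrite (triv i j v) //; apply: low0.
  by apply: low_le Pv; lia.
apply: (resolution_eq0 (half_res H)) => k kD.
(* For [k <= D.-1 - m], each level [l <= m] of [u] satisfies [k + l < D], so [X D] does not reach
   [k] from it. *)
have [hk|hk] := ltnP (D.-1 - m) k; first by apply: Wlow; rewrite hk.
rewrite mulmxA (resolution_expand _ _ (half_res H)) big1 // => l _.
have lD : (l <= D)%N := leq_ord _.
have [ml|lm] := ltnP m l; first by rewrite -mulmxA Pu ?mulmx0 // ml.
by rewrite (half_far H) ?mul0mx //; lia.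
Qed.

Lemma low_low_trivial P Q X Y i j v :
  tridiagonal_half P Q X -> tridiagonal_half Q P Y ->
  (i + j < D)%N -> low P i v -> low Q j v -> v = 0.
Proof.
move=> HX HY ijD Pv Qv.
(* Both bounds advance together: the step for [i = m] uses the bound on [j], and the step for
   [j = m] uses the bound on [i] with [P] and [Q] exchanged. *)
suff main m : (forall i j u, (i + j).+1 = D -> (i < m)%N -> low P i u -> low Q j u -> u = 0)
          /\ (forall i j u, (i + j).+1 = D -> (j < m)%N -> low P i u -> low Q j u -> u = 0).
  have [/(_ i (D.-1 - i)%N v) + _] := main D; apply=> //; [lia|lia|].
  by apply: low_le Qv; lia.
elim: m => [|m [IH1 IH2]]; first by split.
split=> i' j' u ij'; rewrite ltnS leq_eqVlt => /orP[/eqP E|lt] Pu Qu.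
- apply: (diagonal_trivial_step HX IH2 _ _ _ : u = 0); rewrite -?E //; first by lia.
  by rewrite (_ : (_ - _)%N = j') //; lia.
- exact: IH1 lt Pu Qu.
- apply: (@diagonal_trivial_step Q P Y m u HY); rewrite -?E //; last 2 first.
  + by lia.
  + by rewrite (_ : (_ - _)%N = i') //; lia.
  by move=> a b w abD bm Qw Pw; apply: (IH1 b a) => //; lia.
- exact: IH2 lt Pu Qu.
Qed.

End Filtrations.

(** * Distances and intersection numbers *)

Section GraphDistance.
Variables (T : finType) (adj : rel T).
Hypotheses (simp : simple_graph adj) (conn : connected_graph adj).
Local Notation d := (dist adj).
Local Notation D := (diameter adj).

Lemma walk_lenP x y n :
  reflect (exists p, [/\ size p = n, path adj x p & last x p = y]) (walk_len adj x y n).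
Proof.
apply: (iffP existsP) => [[p /andP[px /eqP py]]|[p [sp px py]]].
  by exists p; rewrite size_tuple.
by exists (tcast sp (in_tuple p)); rewrite val_tcast /= px py eqxx.
Qed.

Lemma walk_len_cat x y z m n :
  walk_len adj x y m -> walk_len adj y z n -> walk_len adj x z (m + n).
Proof.
move=> /walk_lenP[p [<- xp <-]] /walk_lenP[q [<- yq <-]]; apply/walk_lenP.
by exists (p ++ q); rewrite size_cat cat_path xp yq last_cat.
Qed.

Lemma walk_len_sym x y n : walk_len adj x y n -> walk_len adj y x n.
Proof.
case: simp => adjC _ /walk_lenP[p [<- xp <-]]; apply/walk_lenP.
exists (rev (belast x p)); rewrite size_rev size_belast; split=> //.
  by rewrite (@eq_path _ _ (fun u v => adj v u)) ?rev_path // => u v; rewrite adjC.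
by case: p {xp} => //= z p; rewrite rev_cons last_rcons.
Qed.

Lemma dist_le x y n : walk_len adj x y n -> (d x y <= n)%N.
Proof.
move=> w; rewrite leqNgt; apply/negP => lt.
have nT : (n < #|T|)%N.
  by apply: leq_trans lt _; rewrite -[leqRHS](size_iota 0) find_size.
by have := before_find 0%N lt; rewrite nth_iota // w.
Qed.

(** A walk without repeated vertices has length below [#|T|], so the search in [dist] succeeds and
    does not return its default [#|T|]. *)
Lemma dist_walk x y : walk_len adj x y (d x y).
Proof.
suff h : has (walk_len adj x y) (iota 0 #|T|).
  by have := nth_find 0%N h; rewrite nth_iota // -{2}(size_iota 0 #|T|) -has_find.
have /connectP[p xp ->] := conn x y.
case/shortenP: xp => q xq uq _; apply/hasP; exists (size q).
  rewrite mem_iota add0n /=; have := uniq_leq_size uq (fun z _ => mem_enum T z).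
  by rewrite -cardE.
by apply/walk_lenP; exists q.
Qed.

Lemma dist_sym x y : d x y = d y x.
Proof. by apply/eqP; rewrite eqn_leq !dist_le //; apply/walk_len_sym/dist_walk. Qed.

Lemma dist_triangle y x z : (d x z <= d x y + d y z)%N.
Proof. by apply/dist_le/walk_len_cat; apply: dist_walk. Qed.

Lemma dist_eq0 x y : (d x y == 0)%N = (x == y).
Proof.
apply/eqP/eqP => [d0|->].
  by have := dist_walk x y; rewrite d0 => /walk_lenP[[|? ?] [//= _ _ ->]].
by apply/eqP; rewrite -leqn0; apply/dist_le/walk_lenP; exists [::].
Qed.

Lemma dist_succ x y n : d x y = n.+1 -> exists z, d x z = 1%N /\ d z y = n.
Proof.
move=> dn; have := dist_walk x y; rewrite dn => /walk_lenP[[|z p] [//= [sp]]].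
case/andP=> xz zp py; exists z.
have h1 : (d z y <= n)%N by apply/dist_le/walk_lenP; exists p.
have h2 : (d x z <= 1)%N by apply/dist_le/walk_lenP; exists [:: z]; rewrite /= xz.
by have := dist_triangle z x y; lia.
Qed.

Lemma dist_diameter x y : (d x y <= D)%N.
Proof.
apply: (leq_trans _ (leq_bigmax x)).
exact: (leq_bigmax (F := fun y => d x y)).
Qed.

(** Start from a pair at distance [D] and move its first vertex along a geodesic, one step at a
    time. *)
Lemma dist_attained i : (0 < #|T|)%N -> (i <= D)%N -> exists x y, d x y = i.
Proof.
move=> T0 iD; have [x xE] := @bigop.eq_bigmax T (fun x => \max_y d x y) T0.
have [y yE] := @bigop.eq_bigmax T (d x) T0.
have : exists x y, d x y = (i + (D - i))%N by exists x, y; rewrite subnKC // -yE -xE.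
elim: (D - i)%N => [|k IHk]; first by rewrite addn0.
rewrite addnS => -[a [b /dist_succ[c [_ dcb]]]].
by apply: IHk; exists c, b.
Qed.

(** Distance-regularity gives the constants only existentially; evaluation at a picked pair makes
    them a function, with default 0 when no pair is at distance [h]. *)
Definition intersection_number (h i j : nat) : nat :=
  if [pick xy : T * T | d xy.1 xy.2 == h] is Some xy then
    #|[set z : T | (d xy.1 z == i) && (d z xy.2 == j)]|
  else 0.

Hypothesis dreg : distance_regular adj.

Lemma intersection_numberE i j x y :
  #|[set z : T | (d x z == i) && (d z y == j)]| = intersection_number (d x y) i j.
Proof.
have [c cE] := dreg (d x y) i j.
rewrite /intersection_number; case: pickP => [xy /eqP /cE ->|/(_ (x, y))]; first exact: cE.
by rewrite eqxx.
Qed.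

(** The first step of a geodesic of length [maxn h i] provides the third vertex; when [i = h.+1] the
    triple is read from that vertex. *)
Lemma intersection_number_neq0 h i :
  (0 < #|T|)%N -> (h <= D)%N -> (i <= D)%N -> (h == i.+1) || (i == h.+1) ->
  intersection_number h 1 i != 0%N.
Proof.
move=> T0 hD iD hi.
have [x [y [z [<- xz zy]]]] : exists x y z, [/\ d x y = h, d x z = 1%N & d z y = i].
  case/orP: hi => /eqP E.
    have [x [y dE]] := dist_attained T0 hD.
    have [z [xz zy]] := dist_succ (etrans dE E).
    by exists x, y, z.
  have [x [y dE]] := dist_attained T0 iD.
  have [z [xz zy]] := dist_succ (etrans dE E).
  by exists z, y, x; split=> //; rewrite dist_sym.
rewrite -intersection_numberE -lt0n; apply/card_gt0P; exists z.
by rewrite inE xz zy !eqxx.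
Qed.

Lemma intersection_number_eq0 h i :
  (i.+1 < h)%N || (h.+1 < i)%N -> intersection_number h 1 i = 0%N.
Proof.
move=> hi; rewrite /intersection_number; case: pickP => // -[x y] /= /eqP dE.
apply/eqP; rewrite cards_eq0; apply/eqP/setP => z; rewrite !inE.
apply/negP => /andP[/eqP xz /eqP zy].
have := dist_triangle z x y; have := dist_triangle x z y; rewrite (dist_sym z x).
lia.
Qed.

End GraphDistance.

(** * The Bose-Mesner algebra *)

Section BoseMesner.
Variables (T : finType) (adj : rel T) (C : numClosedFieldType).
Hypotheses (simp : simple_graph adj) (conn : connected_graph adj).
Hypothesis dreg : distance_regular adj.
Local Notation D := (diameter adj).
Local Notation n := #|T|.
Local Notation A := (distA adj C).
Local Notation BM := (@in_BM T adj C).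
Implicit Types M N : 'M[C]_n.

Lemma BM_distA i : (i <= D)%N -> BM (A i).
Proof.
move=> iD; exists (fun j => (j == i)%:R).
rewrite (bigD1 (Ordinal (iD : (i < D.+1)%N))) //= eqxx scale1r big1 ?addr0 // => j.
by rewrite -val_eqE /= => /negPf ->; rewrite scale0r.
Qed.

Lemma BM0 : BM 0.
Proof. by exists (fun=> 0); rewrite big1 // => i _; rewrite scale0r. Qed.

Lemma BMD M N : BM M -> BM N -> BM (M + N).
Proof.
move=> [c ->] [c' ->]; exists (fun i => c i + c' i).
by rewrite -big_split /=; apply: eq_bigr => i _; rewrite scalerDl.
Qed.

Lemma BMZ a M : BM M -> BM (a *: M).
Proof.
move=> [c ->]; exists (fun i => a * c i).
by rewrite scaler_sumr; apply: eq_bigr => i _; rewrite scalerA.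
Qed.

Lemma BM_sum (I : finType) (P : pred I) (F : I -> 'M[C]_n) :
  (forall i, P i -> BM (F i)) -> BM (\sum_(i | P i) F i).
Proof. by move=> ?; apply: (big_ind BM) => //; [apply: BM0|apply: BMD]. Qed.

Lemma sum_distA (c : nat -> C) a b :
  (\sum_(i < D.+1) c i *: A i) a b = c (dist adj (enum_val a) (enum_val b)).
Proof.
set x := enum_val a; set y := enum_val b.
have lt : (dist adj x y < D.+1)%N by rewrite ltnS dist_diameter.
rewrite summxE (bigD1 (Ordinal lt)) //= !mxE eqxx mulr1 big1 ?addr0 // => i.
by rewrite -val_eqE /= !mxE eq_sym => /negPf ->; rewrite mulr0.
Qed.

Lemma BM_entry M :
  BM M -> exists c : nat -> C, forall a b, M a b = c (dist adj (enum_val a) (enum_val b)).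
Proof. by move=> [c ->]; exists c => a b; rewrite sum_distA. Qed.

Lemma entry_BM M (c : nat -> C) :
  (forall a b, M a b = c (dist adj (enum_val a) (enum_val b))) -> BM M.
Proof. by move=> Mc; exists c; apply/matrixP => a b; rewrite sum_distA. Qed.

Lemma distA0 : A 0%N = 1%:M.
Proof.
by apply/matrixP => a b; rewrite !mxE dist_eq0 // (inj_eq enum_val_inj).
Qed.

Lemma BM1 : BM 1%:M.
Proof. by rewrite -distA0; apply: BM_distA. Qed.

Lemma BM_sym M : BM M -> M^T = M.
Proof.
by move=> /BM_entry[c Mc]; apply/matrixP => a b; rewrite mxE !Mc dist_sym.
Qed.

Lemma distA_mul i j :
  A i *m A j = \sum_(h < D.+1) (intersection_number adj h i j)%:R *: A h.
Proof.
apply/matrixP => a b; rewrite (sum_distA (fun h => (intersection_number adj h i j)%:R)).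
rewrite -intersection_numberE // mxE -sum1_card natr_sum.
rewrite (reindex_onto (@enum_val T T) enum_rank) /=; last by move=> z _; apply: enum_rankK.
rewrite [RHS]big_mkcond /=; apply: eq_bigr => k _; rewrite enum_valK eqxx andbT inE !mxE.
by case: eqP; case: eqP; rewrite ?mulr0 ?mul0r ?mulr1.
Qed.

Lemma BM_mul M N : BM M -> BM N -> BM (M *m N).
Proof.
move=> [c ->] [c' ->]; rewrite mulmx_suml; apply: BM_sum => i _.
rewrite mulmx_sumr; apply: BM_sum => j _; rewrite -scalemxAl -scalemxAr.
apply/BMZ/BMZ; rewrite distA_mul; apply: BM_sum => h _.
by apply/BMZ/BM_distA; rewrite -ltnS.
Qed.

(** The product lies in the algebra, hence is symmetric, and transposing it reverses its factors. *)
Lemma BM_comm M N : BM M -> BM N -> M *m N = N *m M.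
Proof.
by move=> BM_M BM_N; rewrite -(BM_sym (BM_mul BM_M BM_N)) trmx_mul !BM_sym.
Qed.

Lemma BM_conj M : BM M -> BM (map_mx Num.conj M).
Proof.
by move=> /BM_entry[c Mc]; apply: (@entry_BM _ (fun i => (c i)^*)) => a b; rewrite mxE Mc.
Qed.

(** For real [N] this trace is the sum of the squared moduli of the entries. *)
Lemma real_mx_sqr_eq0 m (N : 'M[C]_(n, m)) :
  map_mx Num.conj N = N -> \tr (N *m N^T) = 0 -> N = 0.
Proof.
move=> Nreal tr0; apply/matrixP => a b; rewrite mxE; apply/eqP.
have sq a' b' : N a' b' * N^T b' a' = N a' b' * (N a' b')^*.
  by rewrite mxE -{2}Nreal mxE.
have ge0 a' b' : 0 <= N a' b' * N^T b' a' by rewrite sq mul_conjC_ge0.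
move/eqP: tr0; rewrite psumr_eq0 => [/allP/(_ a)|a' _]; last first.
  by rewrite mxE sumr_ge0.
rewrite mem_index_enum mxE psumr_eq0 // => /(_ isT)/allP/(_ b).
by rewrite mem_index_enum sq mul_conjC_eq0 => /(_ isT).
Qed.

(* Otherwise M and its conjugate are orthogonal; M being symmetric, M M^* = 0. *)
Lemma prim_idem_real M : prim_idem adj M -> map_mx Num.conj M = M.
Proof.
move=> [BM_M idM M0 prim].
set N := map_mx Num.conj M; have BM_N : BM N by apply: BM_conj.
have idN : idem N by rewrite /idem -map_mxM idM.
have NK : map_mx Num.conj N = M by apply/matrixP => a b; rewrite !mxE conjCK.
have MN_BM : BM (M *m N) by apply: BM_mul.
have MN_id : idem (M *m N).
  by rewrite /idem -mulmxA [N *m (M *m N)]mulmxA (BM_comm BM_N) // -(mulmxA M) idN mulmxA idM.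
have MMN : M *m (M *m N) = M *m N by rewrite mulmxA idM.
have [MN|MN] := prim _ MN_BM MN_id MMN.
  case/eqP: M0; apply/matrixP => a b; rewrite mxE.
  have : (M *m N) a a = 0 by rewrite MN mxE.
  rewrite mxE => /eqP; rewrite psumr_eq0 => [/allP/(_ b)|k _].
    rewrite mem_index_enum => /(_ isT) /=.
    by rewrite -(BM_sym BM_N) !mxE mul_conjC_eq0 => /eqP.
  by rewrite -(BM_sym BM_N) !mxE mul_conjC_ge0.
(* Conjugating [M *m N = M] gives [N *m M = N], and the factors commute. *)
have := congr1 (map_mx Num.conj) MN; rewrite map_mxM NK -/N BM_comm //.
by rewrite MN.
Qed.

(** * The basis of primitive idempotents *)

Section Idempotents.
Variable E : nat -> 'M[C]_n.
Hypothesis ordE : prim_idem_ordering adj E.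

Lemma E_prim i : (i <= D)%N -> prim_idem adj (E i).
Proof. by case: ordE => + _ _ _; apply. Qed.

Lemma E_BM i : (i <= D)%N -> BM (E i).
Proof. by move/E_prim => []. Qed.

Lemma E_idem i : (i <= D)%N -> E i *m E i = E i.
Proof. by move/E_prim => []. Qed.

(** The product is an idempotent below both factors; if nonzero, primitivity makes it equal to each
    of them. *)
Lemma E_orth i j : (i <= D)%N -> (j <= D)%N -> i != j -> E i *m E j = 0.
Proof.
move=> iD jD ij; apply/eqP/negPn/negP => EE0; case/eqP: ij.
have [_ injE _ _] := ordE; apply: injE => //.
have [Bi idi _ primi] := E_prim iD; have [Bj idj _ primj] := E_prim jD.
have Bij := BM_mul Bi Bj.
have idij : idem (E i *m E j).
  rewrite /idem -mulmxA [E j *m (E i *m E j)]mulmxA (BM_comm Bj) // -(mulmxA (E i)) idj.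
  by rewrite mulmxA idi.
have [/eqP|<-] := primi _ Bij idij (etrans (mulmxA _ _ _) (congr1 (mulmx^~ _) idi)).
  by rewrite (negPf EE0).
rewrite (BM_comm Bi Bj) in EE0 Bij idij *.
have [/eqP|//] := primj _ Bij idij (etrans (mulmxA _ _ _) (congr1 (mulmx^~ _) idj)).
by rewrite (negPf EE0).
Qed.

(* D + 1 orthogonal idempotents in an algebra spanned by D + 1 matrices form a basis. *)
Lemma BM_expand M : BM M -> exists c : nat -> C, M = \sum_(i < D.+1) c i *: E i.
Proof.
have [c cE] : exists c : nat -> nat -> C,
    forall j, (j <= D)%N -> E j = \sum_(i < D.+1) c j i *: A i.
  have cex (j : 'I_D.+1) : exists c : nat -> C, E j == \sum_(i < D.+1) c i *: A i.
    have jD : (j <= D)%N := leq_ord _.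
    by have [c /eqP cE] := E_BM jD; exists c.
  (* Finite functions and a boolean equation allow [xchoose] to pick the coefficients. *)
  have {}cex (j : 'I_D.+1) : exists c : {ffun 'I_D.+1 -> C}, E j == \sum_i c i *: A i.
    have [c /eqP cE] := cex j; exists [ffun i : 'I__ => c i].
    by rewrite cE; apply/eqP/eq_bigr => i _; rewrite ffunE.
  exists (fun j i => xchoose (cex (inord j)) (inord i)) => j jD.
  transitivity (E (inord j : 'I_D.+1)); first by rewrite inordK ?ltnS.
  apply: etrans (eqP (xchooseP (cex (inord j)))) _.
  by apply: eq_bigr => i _; rewrite inord_val.
pose Q : 'M[C]_D.+1 := \matrix_(j, i) c j i.
(* A left kernel vector is a linear relation among the [E j]; multiplying it by [E k] isolates its
   [k]-th coefficient. *)
have Q_unit : Q \in unitmx.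
  rewrite -row_free_unit -kermx_eq0; apply/rowV0P => r /sub_kermxP rQ.
  have sumE : \sum_(j < D.+1) r 0 j *: E j = 0.
    under eq_bigr => j _ do rewrite cE ?leq_ord // scaler_sumr.
    rewrite exchange_big big1 // => i _.
    under eq_bigr => j _ do rewrite scalerA.
    rewrite -scaler_suml; have := congr1 (fun s : 'rV_ _ => s 0 i) rQ.
    by rewrite !mxE; under eq_bigr => j _ do rewrite mxE; move=> ->; rewrite scale0r.
  apply/rowP => k; rewrite [RHS]mxE; have kD : (k <= D)%N := leq_ord _.
  have := congr1 (mulmx (E k)) sumE; rewrite mulmx0 mulmx_sumr (bigD1 k) //= big1.
    rewrite addr0 -scalemxAr E_idem // => /eqP; rewrite scaler_eq0 => /orP[/eqP//|].
    by case: (E_prim kD) => _ _ /negPf ->.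
  move=> j jk; rewrite -scalemxAr E_orth ?scaler0 ?leq_ord //.
  by rewrite eq_sym val_eqE.
(* [Q] expresses the [E j] through the [A i], so coordinates change by its inverse. *)
move=> [a ->]; pose b := (\row_i a (nat_of_ord i)) *m invmx Q.
exists (fun j => b 0 (inord j)).
transitivity (\sum_(i < D.+1) (b *m Q) 0 i *: A i).
  by apply: eq_bigr => i _; rewrite mulmxKV // mxE.
under eq_bigr => i _ do rewrite mxE scaler_suml.
rewrite exchange_big; apply: eq_bigr => j _; rewrite inord_val cE ?leq_ord // scaler_sumr.
by apply: eq_bigr => i _; rewrite scalerA [Q _ _]mxE.
Qed.

Lemma BM_eigen M : BM M ->
  exists th : nat -> C, forall k, (k <= D)%N -> E k *m M = th k *: E k.
Proof.
move=> /BM_expand[c ->]; exists c => k kD.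
rewrite mulmx_sumr (bigD1 (Ordinal (kD : (k < D.+1)%N))) //= -scalemxAr E_idem //.
rewrite big1 ?addr0 // => j; rewrite -val_eqE /= => jk.
by rewrite -scalemxAr E_orth ?scaler0 ?leq_ord // eq_sym.
Qed.

(** Multiplying the expansion of the identity by [E k] shows that its [k]-th term is [E k]. *)
Lemma E_resolution : resolution D E.
Proof.
have [c cE] := BM_expand BM1.
rewrite /resolution [RHS]cE; apply: eq_bigr => k _.
have kD : (k <= D)%N := leq_ord _.
have := congr1 (mulmx (E k)) cE; rewrite mulmx1 mulmx_sumr (bigD1 k) //= big1.
  by rewrite addr0 -scalemxAr E_idem.
move=> j jk; rewrite -scalemxAr E_orth ?scaler0 ?leq_ord //.
by rewrite eq_sym val_eqE.
Qed.

End Idempotents.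
End BoseMesner.

(** * The primal and dual instances at a base vertex *)

Section TerwilligerAlgebra.
Variables (T : finType) (adj : rel T) (C : numClosedFieldType).
Hypotheses (simp : simple_graph adj) (conn : connected_graph adj).
Hypothesis dreg : distance_regular adj.
Hypothesis D_gt0 : (0 < diameter adj)%N.
Local Notation D := (diameter adj).
Local Notation n := #|T|.
Local Notation A := (distA adj C).
Variable E : nat -> 'M[C]_n.
Hypothesis ordE : prim_idem_ordering adj E.
Variable x : 'I_n.
Local Notation d a := (dist adj (enum_val x) (enum_val a)).

(* In Terwilliger's notation: E*_k(x) and |X|^-1 A*_i(x). *)
Definition dual_idem (k : nat) : 'M[C]_n := diag_mx (\row_a (d a == k)%:R).

Definition dual_dist (i : nat) : 'M[C]_n := diag_mx (row x (E i)).

Lemma card_gt0_ord : (0 < n)%N.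
Proof. exact: leq_ltn_trans (leq0n _) (ltn_ord x). Qed.

Lemma mul_dual_idem k (M : 'M[C]_n) l a b :
  (dual_idem k *m M *m dual_idem l) a b = (d a == k)%:R * M a b * (d b == l)%:R.
Proof. by rewrite mul_mx_diag mul_diag_mx !mxE. Qed.

Lemma dual_idem_resolution : resolution D dual_idem.
Proof.
apply/matrixP => a b; rewrite summxE.
have lt : (d a < D.+1)%N by rewrite ltnS dist_diameter.
rewrite (bigD1 (Ordinal lt)) //= big1 => [|k]; first by rewrite !mxE eqxx addr0.
by rewrite -val_eqE /= eq_sym !mxE => /negPf ->; rewrite mul0rn.
Qed.

Lemma distA_three_term : three_term D A.
Proof.
exists (fun h i => (intersection_number adj h 1 i)%:R); split=> [i _|h i _ _ hi|h i hD iD hi].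
- exact: distA_mul.
- by rewrite intersection_number_eq0.
- by rewrite pnatr_eq0 intersection_number_neq0 // card_gt0_ord.
Qed.

(** [half_tri] and [half_far] are triangle inequalities: a nonzero entry of $E^*_k A_i E^*_l$
    requires $k - l \le i \le k + l$. *)
Lemma primal_half : tridiagonal_half D dual_idem E A.
Proof.
split.
- exact: dual_idem_resolution.
- exact: E_resolution.
- by apply: BM_eigen => //; apply: BM_distA.
- move=> k l _ _ lk; apply/matrixP => a b; rewrite mul_dual_idem !mxE.
  case: eqP => [ak|]; last by rewrite !mul0r.
  case: eqP => [ab|]; last by rewrite mulr0 mul0r.
  case: eqP => [bl|]; last by rewrite mulr0.
  exfalso.
  have := dist_triangle conn (enum_val b) (enum_val x) (enum_val a).
  by rewrite (dist_sym simp conn (enum_val b) (enum_val a)) ak bl ab; lia.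
- move=> k l _ _ kl; apply/matrixP => a b; rewrite mul_dual_idem !mxE.
  case: eqP => [ak|]; last by rewrite !mul0r.
  case: eqP => [ab|]; last by rewrite mulr0 mul0r.
  case: eqP => [bl|]; last by rewrite mulr0.
  exfalso.
  have := dist_triangle conn (enum_val x) (enum_val a) (enum_val b).
  by rewrite (dist_sym simp conn (enum_val a) (enum_val x)) ak bl ab; lia.
- exact: distA_three_term.
- by exists 1; rewrite ?oner_neq0 // distA0.
Qed.

Variable q : nat -> nat -> nat -> C.
Hypothesis q_hadamard : forall i j, (i <= D)%N -> (j <= D)%N ->
  hadamard (E i) (E j) = (n%:R)^-1 *: \sum_(h < D.+1) q h i j *: E h.
Hypothesis q_eq0 : forall h i j, (h <= D)%N -> (i <= D)%N -> (j <= D)%N ->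
  ((i + j < h)%N || (h + j < i)%N || (h + i < j)%N) -> q h i j = 0.
Hypothesis q_neq0 : forall h i j, (h <= D)%N -> (i <= D)%N -> (j <= D)%N ->
  ((h == i + j)%N || (i == h + j)%N || (j == h + i)%N) -> q h i j != 0.

(* With N = E_k A*_i E_j real, tr (N N^T) = tr (E_k A*_i E_j A*_i) is, up to a positive scalar,
   the (x, x) entry of E_i (E_k o E_j) E_i, which is |X|^-1 q^i_kj E_i(x, x). *)
Lemma triple_product_eq0 k i j :
  (k <= D)%N -> (i <= D)%N -> (j <= D)%N -> q i k j = 0 ->
  E k *m dual_dist i *m E j = 0.
Proof.
move=> kD iD jD q0; set S := dual_dist i.
have Esym h : (h <= D)%N -> (E h)^T = E h.
  by move=> hD; apply: (BM_sym simp conn); apply: E_BM ordE _ _.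
have Ereal h : (h <= D)%N -> map_mx Num.conj (E h) = E h.
  by move=> hD; apply: (prim_idem_real simp conn dreg); apply: E_prim ordE _ _.
have Sreal : map_mx Num.conj S = S.
  by rewrite map_diag_mx map_row Ereal.
apply: real_mx_sqr_eq0; first by rewrite !map_mxM !Ereal // Sreal.
rewrite !trmx_mul !Esym // tr_diag_mx -/S.
rewrite -(mulmxA (E k *m S)) (mulmxA (E j)) (E_idem ordE jD) mxtrace_mulC.
rewrite -!mulmxA (mulmxA (E k)) (E_idem ordE kD).
(* As [S] is diagonal with entries $E_i(x,a)$, both sides are the sum over $a, b$ of $E_i(x,a)
   E_k(a,b) E_j(a,b) E_i(b,x)$. *)
have -> : \tr (E j *m (S *m (E k *m S))) = (E i *m hadamard (E k) (E j) *m E i) x x.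
  rewrite /mxtrace mxE; apply: eq_bigr => a _; rewrite mxE mxE mulr_suml.
  apply: eq_bigr => b _; rewrite mul_diag_mx mul_mx_diag !mxE.
  have -> : E i a x = E i x a by rewrite -[in LHS](Esym i iD) mxE.
  have -> : E j a b = E j b a by rewrite -[in LHS](Esym j jD) mxE.
  by rewrite mulrC -!mulrA [E i x a * _]mulrC.
(* Between the two factors [E i] only the term [h = i] survives, and its coefficient is
   [q i k j = 0]. *)
rewrite q_hadamard // -scalemxAr -scalemxAl mxE mulmx_sumr mulmx_suml summxE big1 ?mulr0 //.
move=> h _; rewrite -scalemxAr -scalemxAl.
have [<-|ih] := eqVneq i h; first by rewrite q0 scale0r mxE.
by rewrite (E_orth simp conn dreg ordE) ?leq_ord // mul0mx scaler0 mxE.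
Qed.

(** Diagonal matrices multiply entrywise, so this is row [x] of the Krein expansion of $E_1 \circ
    E_i$. *)
Lemma dual_dist_three_term : three_term D dual_dist.
Proof.
exists (fun h i => (n%:R)^-1 * q h 1 i); split=> [i iD|h i hD iD hi|h i hD iD hi].
- have := q_hadamard D_gt0 iD => qh; apply/matrixP => a b.
  rewrite mul_diag_mx summxE !mxE mulrnAr.
  have := congr1 (fun M : 'M_n => M x b) qh.
  rewrite !mxE => Eh; have [->|ab] := eqVneq a b; last first.
    by rewrite mulr0n big1 // => h _; rewrite !mxE (negPf ab) mulr0n mulr0.
  rewrite mulr1n Eh summxE mulr_sumr; apply: eq_bigr => h _.
  by rewrite !mxE eqxx mulr1n mulrA.
- by rewrite q_eq0 ?mulr0 //; lia.
- rewrite mulf_neq0 ?invr_eq0 ?pnatr_eq0 -?lt0n ?card_gt0_ord // q_neq0 //; lia.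
Qed.

(** The triangle inequalities are replaced by the vanishing of $q^1_{kl}$ for $l + 1 < k$ and of
    $q^D_{kl}$ for $k + l < D$. The dual eigenvalues are the values of $E_1(x,y)$ at each
    distance. *)
Lemma dual_half : tridiagonal_half D E dual_idem dual_dist.
Proof.
split.
- exact: E_resolution.
- exact: dual_idem_resolution.
- have [c cE] := BM_entry (E_BM ordE D_gt0); exists c => k kD.
  apply/matrixP => a b; rewrite mul_diag_mx !mxE cE.
  have [->|ab] := eqVneq a b; last by rewrite !mulr0n !mulr0.
  rewrite !mulr1n; case: eqP => [->|]; first by rewrite mulrC.
  by rewrite mul0r mulr0.
- move=> k l kD lD lk; apply: triple_product_eq0 => //; apply: q_eq0 => //.
  by rewrite add1n lk orbT.
- move=> k l kD lD kl; apply: triple_product_eq0 => //; apply: q_eq0 => //.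
  by rewrite kl.
- exact: dual_dist_three_term.
- have n0 : (n%:R : C) != 0 by rewrite pnatr_eq0 -lt0n card_gt0_ord.
  exists (n%:R)^-1; first by rewrite invr_eq0.
  case: ordE => _ _ _ E0; apply/matrixP => a b.
  by rewrite /dual_dist E0 !mxE mulr1.
Qed.

End TerwilligerAlgebra.

(** * Dual width against distance to the support *)

Theorem mainTheorem11 (T : finType) (adj : rel T) (C : numClosedFieldType)
    (E : nat -> 'M[C]_#|T|) (v : 'cV[C]_#|T|) :
  simple_graph adj ->
  connected_graph adj ->
  distance_regular adj ->
  (3 <= diameter adj)%N ->
  prim_idem_ordering adj E ->
  Q_polynomial adj E ->
  v != 0 ->
  forall x : T, exists2 y : T, y \in vsupport v &
    (diameter adj - dual_width adj E v <= dist adj x y)%N.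
Proof.
move=> simp conn dreg D3 ordE [q [qE [q0 q1]]] v0 x.
have D0 : (0 < diameter adj)%N by apply: leq_trans D3.
set D := diameter adj in D0 qE q0 q1 *; set g := dual_width adj E v.
case: (boolP [exists y, (y \in vsupport v) && (D - g <= dist adj x y)%N]).
  by case/existsP=> y /andP[]; exists y.
move=> /existsPn far; case/eqP: v0.
have near a : (D - g <= dist adj x (enum_val a))%N -> v a 0 = 0.
  have := far (enum_val a); rewrite inE enum_valK negb_and negbK.
  by case/orP=> [/eqP //|/negPf ->].
(* If [D <= g], the truncated difference is 0 and [near] covers every vertex; otherwise [D.-1 - g]
   is a genuine level. *)
have [Dg|gD] := leqP D g.
  apply/colP => a; rewrite mxE; apply: near.
  by rewrite (eqP (_ : D - g == 0)%N) ?subn_eq0.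
(* [v] is supported within distance [D.-1 - g] of [x] and killed by [E k] for [k > g]; the two
   levels add up to [D.-1]. *)
apply: (low_low_trivial (primal_half simp conn dreg D0 ordE (enum_rank x))
          (dual_half simp conn dreg D0 ordE (enum_rank x) qE q0 q1)
          (_ : (D.-1 - g) + g < D)%N); first by lia.
- move=> k /andP[gk kD]; apply/colP => a; rewrite mul_diag_mx !mxE enum_rankK.
  case: eqP => [ak|]; last by rewrite mul0r.
  by rewrite near ?mulr0 // ak; lia.
- move=> k /andP[gk kD]; apply/eqP/negPn/negP => Ekv.
  suff : (k <= g)%N by rewrite leqNgt gk.
  exact: (leq_bigmax_cond (F := fun i : 'I_D.+1 => val i) (Ordinal (kD : (k < D.+1)%N)) Ekv).
Qed.
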